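(* Let $U=\{\xi_1,\dots,\xi_p\}\subset\mathbb{R}^k$ be a finite nonempty set, let $\Lambda=\{1,\dots,m\}$, $\bar\Lambda=\{1,\dots,p\}$, and for every $j\in\Lambda$, $i\in\bar\Lambda$ let $\zeta_j(\cdot,\xi_i):\mathbb{R}^n\to\mathbb{R}$ be twice continuously differentiable and strictly convex. Let $F_j(x)=\max_{i\in\bar\Lambda}\zeta_j(x,\xi_i)$. Fix $x\in\mathbb{R}^n$ and let $H_j(x,\xi_i)\in\mathbb{R}^{n\times n}$ be a symmetric positive definite matrix (an approximation of $\nabla^2\zeta_j(x,\xi_i)$) for each $j\in\Lambda$, $i\in\bar\Lambda$. Then the problem $$\min_{s\in\mathbb{R}^n}\ \max_{j\in\Lambda}\max_{i\in\bar\Lambda}\Big\{\zeta_j(x,\xi_i)+\nabla\zeta_j(x,\xi_i)^Ts+\tfrac12 s^TH_j(x,\xi_i)s-F_j(x)\Big\}$$ has a unique solution $s(x)$, and it is given by $$s(x)=-\Big(\sum_{j\in\Lambda}\sum_{i\in\bar\Lambda}\lambda_{ij}H_j(x,\xi_i)\Big)^{-1}\sum_{j\in\Lambda}\sum_{i\in\bar\Lambda}\lambda_{ij}\nabla\zeta_j(x,\xi_i),$$ where $\lambda_{ij}\ge0$, $\sum_{j\in\Lambda}\sum_{i\in\bar\Lambda}\lambda_{ij}=1$, are Karush–Kuhn–Tucker multipliers (which exist) of the equivalent convex program $Q_N(x)$ described in the context.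
   Context: Gradients are with respect to $x$. The program $Q_N(x)$ is: minimize $t$ over $(t,s)\in\mathbb{R}\times\mathbb{R}^n$ subject to $\zeta_j(x,\xi_i)+\nabla\zeta_j(x,\xi_i)^Ts+\frac12s^TH_j(x,\xi_i)s-F_j(x)\le t$ for all $i\in\bar\Lambda$, $j\in\Lambda$. KKT multipliers at its solution $(t,s)$ are numbers $\lambda_{ij}\ge0$ with $\sum_j\sum_i\lambda_{ij}=1$, $\sum_j\sum_i\lambda_{ij}\big(\nabla\zeta_j(x,\xi_i)+H_j(x,\xi_i)s\big)=0$, and $\lambda_{ij}\big(\zeta_j(x,\xi_i)+\nabla\zeta_j(x,\xi_i)^Ts+\frac12s^TH_j(x,\xi_i)s-F_j(x)-t\big)=0$ for all $i,j$. *)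

(* Defs.v *)
From HB Require Import structures.
From mathcomp Require Import all_boot all_order all_algebra.
From mathcomp Require Import all_classical all_reals all_analysis.
Set Implicit Arguments.
Unset Strict Implicit.
Unset Printing Implicit Defensive.
Import Order.TTheory GRing.Theory Num.Theory.
Import numFieldNormedType.Exports.
Local Open Scope classical_set_scope.
Local Open Scope ring_scope.

Definition dotcv (R : realType) (n : nat) (u v : 'cV[R]_n) : R :=
  (u^T *m v) 0 0.

Definition partial (R : realType) (n : nat) (i : 'I_n) (f : 'cV[R]_n -> R) :
    'cV[R]_n -> R :=
  fun x => 'D_(delta_mx i 0 : 'cV[R]_n) f x.

Definition gradient (R : realType) (n : nat) (f : 'cV[R]_n -> R)
    (x : 'cV[R]_n) : 'cV[R]_n :=
  \col_i partial i f x.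

Definition C1 (R : realType) (n : nat) (f : 'cV[R]_n -> R) : Prop :=
  [/\ continuous f,
      forall i x, derivable f x (delta_mx i 0 : 'cV[R]_n) &
      forall i, continuous (partial i f)].

Definition C2 (R : realType) (n : nat) (f : 'cV[R]_n -> R) : Prop :=
  C1 f /\ forall i, C1 (partial i f).

Definition strictly_convex (R : realType) (n : nat) (f : 'cV[R]_n -> R) :
    Prop :=
  forall (x y : 'cV[R]_n) (a : R), x != y -> 0 < a -> a < 1 ->
    f (a *: x + (1 - a) *: y) < a * f x + (1 - a) * f y.

Definition sym_posdef (R : realType) (n : nat) (A : 'M[R]_n) : Prop :=
  A^T = A /\ forall v : 'cV[R]_n, v != 0 -> 0 < dotcv v (A *m v).

(* Starting the iterated maximum at the value in [ord0] makes it the genuine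
   maximum of a nonempty family, whatever the signs of its members. *)
Definition maxI (R : realType) (n : nat) (f : 'I_n.+1 -> R) : R :=
  \big[Num.max/f ord0]_(i < n.+1) f i.

Definition minimizer (R : realType) (T : Type) (D : set T) (f : T -> R)
    (z : T) : Prop :=
  D z /\ forall z', D z' -> f z <= f z'.

Section Subproblem.
Context (R : realType) (n k m p : nat).
Context (zeta : 'I_m.+1 -> 'cV[R]_n -> 'cV[R]_k -> R).
Context (xi : 'I_p.+1 -> 'cV[R]_k).
Context (H : 'I_m.+1 -> 'cV[R]_n -> 'cV[R]_k -> 'M[R]_n).
Context (x : 'cV[R]_n).

Definition Fmax (j : 'I_m.+1) : R := maxI (fun i => zeta j x (xi i)).

Definition grad_zeta (j : 'I_m.+1) (i : 'I_p.+1) : 'cV[R]_n :=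
  gradient (fun y => zeta j y (xi i)) x.

Definition quad_model (j : 'I_m.+1) (i : 'I_p.+1) (s : 'cV[R]_n) : R :=
  zeta j x (xi i) + dotcv (grad_zeta j i) s
    + 2^-1 * dotcv s (H j x (xi i) *m s) - Fmax j.

Definition subproblem_obj (s : 'cV[R]_n) : R :=
  maxI (fun j => maxI (fun i => quad_model j i s)).

Definition subproblem_solution (s : 'cV[R]_n) : Prop :=
  minimizer setT subproblem_obj s.

Definition QN_feasible : set (R * 'cV[R]_n) :=
  [set ts | forall i j, quad_model j i ts.2 <= ts.1].

Definition QN_solution (ts : R * 'cV[R]_n) : Prop :=
  minimizer QN_feasible fst ts.

Definition KKT_multipliers (ts : R * 'cV[R]_n)
    (lam : 'I_p.+1 -> 'I_m.+1 -> R) : Prop :=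
  [/\ forall i j, 0 <= lam i j,
      \sum_j \sum_i lam i j = 1,
      \sum_j \sum_i lam i j *: (grad_zeta j i + H j x (xi i) *m ts.2) = 0 &
      forall i j, lam i j * (quad_model j i ts.2 - ts.1) = 0].

End Subproblem.

(* Main.v *)
(** Lagrangian duality for finitely many strictly convex quadratics [q_k].  For
weights [a] in the simplex, [sum_k a_k q_k] is again such a quadratic, minimised
at [s(a) = - (sum_k a_k H_k)^-1 (sum_k a_k g_k)], and its minimum value, the
dual function, is continuous in [a], hence has a maximiser [a].  First-order
optimality of [a] says that every [q_k (s(a))] is at most the dual value, so
[s(a)] minimises [max_k q_k] and [a] is a vector of KKT multipliers; strict
convexity of [sum_k a_k q_k] makes the minimiser unique. *)
Require Import Defs.
From HB Require Import structures.
From mathcomp Require Import all_boot all_order all_algebra.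
From mathcomp Require Import all_classical all_reals all_analysis.
From mathcomp Require Import ring lra.
Set Implicit Arguments.
Unset Strict Implicit.
Unset Printing Implicit Defensive.
Import Order.TTheory GRing.Theory Num.Theory.
Import numFieldNormedType.Exports.
Local Open Scope classical_set_scope.
Local Open Scope ring_scope.

(** * Bilinearity and symmetry of the dot product *)

Section DotProduct.
Variables (R : realType) (n : nat).
Implicit Types u v w : 'cV[R]_n.

Lemma dotcvC u v : dotcv u v = dotcv v u.
Proof. by rewrite /dotcv !mxE; apply: eq_bigr => i _; rewrite !mxE mulrC. Qed.

Lemma dotcvDr u v w : dotcv u (v + w) = dotcv u v + dotcv u w.
Proof. by rewrite /dotcv mulmxDr mxE. Qed.

Lemma dotcvDl u v w : dotcv (v + w) u = dotcv v u + dotcv w u.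
Proof. by rewrite dotcvC dotcvDr !(dotcvC u). Qed.

Lemma dotcvZr a u v : dotcv u (a *: v) = a * dotcv u v.
Proof. by rewrite /dotcv -scalemxAr mxE. Qed.

Lemma dotcvNr u v : dotcv u (- v) = - dotcv u v.
Proof. by rewrite /dotcv mulmxN mxE. Qed.

Lemma dotcv_sumr (I : finType) u (v : I -> 'cV[R]_n) :
  dotcv u (\sum_i v i) = \sum_i dotcv u (v i).
Proof. by rewrite /dotcv mulmx_sumr summxE. Qed.

Lemma dotcv_sym (A : 'M[R]_n) u v :
  A^T = A -> dotcv u (A *m v) = dotcv v (A *m u).
Proof. by move=> AT; rewrite dotcvC /dotcv trmx_mul AT mulmxA. Qed.

End DotProduct.

(** * Positive definite matrices: invertibility and convex combinations *)

Section PositiveDefinite.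
Variables (R : realType) (n : nat).

(** A row [u] of the kernel satisfies [u *m A = 0], so the quadratic form vanishes at [u^T], which
    forces [u = 0]. *)
Lemma posdef_unitmx (A : 'M[R]_n) : sym_posdef A -> A \in unitmx.
Proof.
case=> _ posA; rewrite -row_free_unit -kermx_eq0; apply/eqP/row_matrixP => i.
rewrite row0; set u := row i _.
have uA : u *m A = 0 by rewrite /u -row_mul mulmx_ker row0.
apply: contrapT => /eqP u0; have := posA u^T.
rewrite trmx_eq0 => /(_ u0).
by rewrite /dotcv trmxK mulmxA uA mul0mx mxE ltxx.
Qed.

Lemma posdef_ge0 (A : 'M[R]_n) (v : 'cV[R]_n) :
  sym_posdef A -> 0 <= dotcv v (A *m v).
Proof.
case=> _ posA; have [->|/posA/ltW//] := eqVneq v 0.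
by rewrite /dotcv !mulmx0 mxE.
Qed.

(** If the mixed form vanished at some [v != 0], every weight would be zero, against
    [\sum_i a i = 1]. *)
Lemma posdef_mix (I : finType) (a : I -> R) (A : I -> 'M[R]_n) :
    (forall i, 0 <= a i) -> \sum_i a i = 1 -> (forall i, sym_posdef (A i)) ->
  sym_posdef (\sum_i a i *: A i).
Proof.
move=> a0 a1 pA; split.
  by rewrite linear_sum; apply: eq_bigr => i _; rewrite linearZ/= (pA i).1.
move=> v v0; rewrite mulmx_suml dotcv_sumr.
under eq_bigr do rewrite -scalemxAl dotcvZr.
have ge0 i : 0 <= a i * dotcv v (A i *m v).
  by rewrite mulr_ge0// posdef_ge0.
rewrite lt_def sumr_ge0 // andbT psumr_eq0//; apply/negP => /allP zero.
suff : \sum_i a i = 0 by rewrite a1 => /eqP; rewrite oner_eq0.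
apply: big1 => i _; have := zero i (mem_index_enum i); rewrite mulf_eq0.
by case/orP => /eqP // Avv; have := (pA i).2 v v0; rewrite Avv ltxx.
Qed.

End PositiveDefinite.

(** * Quadratic functions and completion of the square *)

Section QuadraticModel.
Variables (R : realType) (n : nat).
Implicit Types (c : R) (g s : 'cV[R]_n) (A : 'M[R]_n).

Definition quad c g A s : R := c + dotcv g s + 2^-1 * dotcv s (A *m s).

Lemma quad_mix (I : finType) (a c : I -> R) (g : I -> 'cV[R]_n)
    (A : I -> 'M[R]_n) s :
  quad (\sum_i a i * c i) (\sum_i a i *: g i) (\sum_i a i *: A i) s =
  \sum_i a i * quad (c i) (g i) (A i) s.
Proof.
rewrite /quad (dotcvC _ s) mulmx_suml !dotcv_sumr mulr_sumr -!big_split/=.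
apply: eq_bigr => i _.
by rewrite -scalemxAl !dotcvZr (dotcvC s (g i)); ring.
Qed.

(** The expansion around [s0] has linear term [dotcv (g + A *m s0) (s - s0)], which vanishes because
    [s0] is stationary. *)
Lemma quad_complete_square c g A s0 s : A^T = A -> A *m s0 = - g ->
  quad c g A s = quad c g A s0 + 2^-1 * dotcv (s - s0) (A *m (s - s0)).
Proof.
move=> AT As0; rewrite -{1}(subrK s0 s); move: (s - s0) => d.
rewrite /quad mulmxDr !dotcvDr !dotcvDl (dotcv_sym s0 d AT) As0 !dotcvNr.
by rewrite (dotcvC d g) (dotcvC s0 g); lra.
Qed.

Lemma quad_min c g A s0 s : sym_posdef A -> A *m s0 = - g ->
  quad c g A s0 <= quad c g A s.
Proof.
move=> pA /(quad_complete_square c s pA.1) ->.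
by rewrite lerDl mulr_ge0 ?invr_ge0// posdef_ge0.
Qed.

Lemma quad_min_strict c g A s0 s : sym_posdef A -> A *m s0 = - g -> s != s0 ->
  quad c g A s0 < quad c g A s.
Proof.
move=> pA /(quad_complete_square c s pA.1) -> ss0.
by rewrite ltrDl mulr_gt0 ?invr_gt0// pA.2// subr_eq0.
Qed.

End QuadraticModel.

(** * Limits of matrix expressions, entry by entry *)

Section EntrywiseLimits.
Variables (R : realType) (T : Type) (F : set_system T).
Context {FF : Filter F}.

Lemma cvgr_sum (I : Type) (r : seq I) (P : pred I) (f : I -> T -> R)
    (l : I -> R) : (forall i, P i -> f i x @[x --> F] --> l i) ->
  \sum_(i <- r | P i) f i x @[x --> F] --> \sum_(i <- r | P i) l i.
Proof. by apply: cvg_big; exact: add_continuous. Qed.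

Lemma cvgr_prod (I : Type) (r : seq I) (P : pred I) (f : I -> T -> R)
    (l : I -> R) : (forall i, P i -> f i x @[x --> F] --> l i) ->
  \prod_(i <- r | P i) f i x @[x --> F] --> \prod_(i <- r | P i) l i.
Proof. by apply: cvg_big; exact: mul_continuous. Qed.

Lemma cvg_mulmx_entry n m p (A : T -> 'M[R]_(n, m)) (B : T -> 'M[R]_(m, p))
    (A0 : 'M[R]_(n, m)) (B0 : 'M[R]_(m, p)) :
    (forall i j, A x i j @[x --> F] --> A0 i j) ->
    (forall i j, B x i j @[x --> F] --> B0 i j) ->
  forall i j, (A x *m B x) i j @[x --> F] --> (A0 *m B0) i j.
Proof.
move=> cA cB i j; rewrite mxE; under eq_fun do rewrite mxE.
by apply: cvgr_sum => k _; exact: cvgM.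
Qed.

Lemma cvg_dotcv n (u v : T -> 'cV[R]_n) (u0 v0 : 'cV[R]_n) :
    (forall i j, u x i j @[x --> F] --> u0 i j) ->
    (forall i j, v x i j @[x --> F] --> v0 i j) ->
  dotcv (u x) (v x) @[x --> F] --> dotcv u0 v0.
Proof.
move=> cu cv; apply: (cvg_mulmx_entry (A := fun x => (u x)^T)) => // i j.
by rewrite mxE; under eq_fun do rewrite mxE; exact: cu.
Qed.

(** By the Leibniz formula the determinant is a polynomial in the entries. *)
Lemma cvg_det n (A : T -> 'M[R]_n) (A0 : 'M[R]_n) :
    (forall i j, A x i j @[x --> F] --> A0 i j) ->
  \det (A x) @[x --> F] --> \det A0.
Proof.
move=> cA; rewrite /determinant; apply: cvgr_sum => s _.
by apply: cvgM; [exact: cvg_cst|apply: cvgr_prod => i _; exact: cA].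
Qed.

(** Cramer's rule: the entries of the inverse are cofactors divided by a determinant whose limit is
    nonzero. *)
Lemma cvg_invmx_entry n (A : T -> 'M[R]_n) (A0 : 'M[R]_n) :
    A0 \in unitmx -> (forall i j, A x i j @[x --> F] --> A0 i j) ->
  forall i j, invmx (A x) i j @[x --> F] --> invmx A0 i j.
Proof.
move=> uA0 cA i j.
have det0 : \det A0 != 0 by rewrite -unitfE -unitmxE.
have cdet := cvg_det cA.
have cvg_formula : (\det (A x))^-1 * (\adj (A x)) i j @[x --> F] -->
    (\det A0)^-1 * (\adj A0) i j.
  apply: cvgM; first exact: cvgV.
  rewrite mxE; under eq_fun do rewrite mxE.
  apply: cvgM; first exact: cvg_cst.
  apply: cvg_det => k l; rewrite 2!mxE; under eq_fun do rewrite 2!mxE.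
  exact: cA.
(* [invmx] follows the adjugate formula only on invertible matrices, so it agrees with that formula
   only eventually, once [\det (A x)] is nonzero. *)
rewrite /invmx uA0 mxE; apply: cvg_trans cvg_formula; apply: near_eq_cvg.
apply: filterS (cvgr_neq0 _ cdet det0) => x dx.
by rewrite unitmxE unitfE dx !mxE.
Qed.

End EntrywiseLimits.

(** * The simplex of weights and its compactness *)

Section Simplex.
Variables (R : realType) (N : nat).

(** Weights are row vectors because the compactness and extreme value theorems applied to them are
    stated for ['rV]. *)
Definition simplex : set 'rV[R]_N :=
  [set a | (forall i, 0 <= a 0 i) /\ \sum_i a 0 i = 1].

Lemma simplex_le1 a : simplex a -> forall i, a 0 i <= 1.
Proof.
by case=> a0 <- i; rewrite (bigD1 i)//= lerDl sumr_ge0.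
Qed.

Lemma simplex_delta i : simplex (delta_mx 0 i).
Proof.
split=> [j|]; first by rewrite mxE ler0n.
rewrite (bigD1 i)//= mxE !eqxx big1 ?addr0// => j /negPf ji.
by rewrite mxE ji.
Qed.

Lemma simplex_convex (a b : 'rV[R]_N) (e : R) : 0 <= e <= 1 ->
  simplex a -> simplex b -> simplex ((1 - e) *: a + e *: b).
Proof.
move=> /andP[e0 e1] [a0 a1] [b0 b1]; split=> [i|].
  by rewrite !mxE addr_ge0// mulr_ge0// subr_ge0.
under eq_bigr do rewrite !mxE.
by rewrite big_split/= -!mulr_sumr a1 b1; ring.
Qed.

Lemma cvg_segment_entry (a b : 'rV[R]_N) k :
  ((1 - e) *: a + e *: b) 0 k @[e --> 0^'+] --> a 0 k.
Proof.
apply: cvg_at_right_filter.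
have -> : a 0 k = (1 - 0) * a 0 k + 0 * b 0 k.
  by rewrite subr0 mul1r mul0r addr0.
under eq_fun do rewrite !mxE.
apply: cvgD; apply: cvgM; try exact: cvg_cst; last exact: cvg_id.
by apply: cvgB; [exact: cvg_cst|exact: cvg_id].
Qed.

(** The simplex is cut out by closed conditions inside the cube [[0, 1]^N], a compact product of
    segments. *)
Lemma compact_simplex : compact simplex.
Proof.
apply: (@subclosed_compact _ _
  [set a : 'rV[R]_N | forall i, `[0, 1]%classic (a ord0 i)]).
- have -> : simplex = \bigcap_(i in [set: 'I_N])
      ((fun a : 'rV[R]_N => a 0 i) @^-1` [set r | 0 <= r]) `&`
      (fun a : 'rV[R]_N => \sum_i a 0 i) @^-1` [set r | r = 1].
    by apply/seteqP; split=> a [a0 a1]; split=> // i *; exact: a0.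
  apply: closedI.
    apply: closed_bigI => i _; apply: closed_comp; last exact: closed_ge.
    by move=> a _; exact: coord_continuous.
  apply: closed_comp; last exact: closed_eq.
  by move=> a _; apply: (@cvgr_sum _ _ (nbhs a)) => i _; exact: coord_continuous.
- exact: (@rV_compact R N (fun=> `[0, 1]%classic) (fun=> @segment_compact R 0 1)).
- by move=> a sa i /=; rewrite in_itv/= sa.1 simplex_le1.
Qed.

End Simplex.

(** * The Lagrangian dual of a finite family of quadratics *)

Section DualOfQuadraticMinimax.
Variables (R : realType) (n N : nat).
Variables (c : 'I_N -> R) (g : 'I_N -> 'cV[R]_n) (A : 'I_N -> 'M[R]_n).
Hypothesis pA : forall k, sym_posdef (A k).
Implicit Type a : 'rV[R]_N.

Definition mix_cst a : R := \sum_k a 0 k * c k.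
Definition mix_grad a : 'cV[R]_n := \sum_k a 0 k *: g k.
Definition mix_hess a : 'M[R]_n := \sum_k a 0 k *: A k.
Definition mix_quad a := quad (mix_cst a) (mix_grad a) (mix_hess a).
Definition mix_argmin a : 'cV[R]_n := - (invmx (mix_hess a) *m mix_grad a).
Definition dual_value a : R := mix_quad a (mix_argmin a).

Lemma mix_quadE a s :
  mix_quad a s = \sum_k a 0 k * quad (c k) (g k) (A k) s.
Proof. exact: quad_mix. Qed.

Lemma mix_hess_posdef a : simplex a -> sym_posdef (mix_hess a).
Proof. by case=> a0 a1; exact: posdef_mix. Qed.

Lemma mix_argminE a : simplex a ->
  mix_hess a *m mix_argmin a = - mix_grad a.
Proof.
move=> /mix_hess_posdef/posdef_unitmx ua.
by rewrite /mix_argmin mulmxN mulmxA mulmxV// mul1mx.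
Qed.

Lemma dual_value_le a s : simplex a -> dual_value a <= mix_quad a s.
Proof.
by move=> sa; apply: quad_min; [exact: mix_hess_posdef|exact: mix_argminE].
Qed.

(** The arbitrary filter serves two uses: continuity of the dual, and the limit along a segment as
    its parameter decreases to 0. Invertibility is asked at the limit [a] alone, since
    neighbourhoods of [a] may leave the simplex. *)
Lemma cvg_mix_argmin (T : Type) (F : set_system T) {FF : Filter F}
    (b : T -> 'rV[R]_N) (a : 'rV[R]_N) : simplex a ->
    (forall k, b x 0 k @[x --> F] --> a 0 k) ->
  forall i j, mix_argmin (b x) i j @[x --> F] --> mix_argmin a i j.
Proof.
move=> sa cb i j; rewrite mxE; under eq_fun do rewrite mxE.
apply: cvgN; apply: cvg_mulmx_entry => {}i {}j.
  apply: cvg_invmx_entry; first exact/posdef_unitmx/mix_hess_posdef.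
  move=> {}i {}j; rewrite summxE; under eq_fun do rewrite summxE.
  apply: cvgr_sum => k _; rewrite mxE; under eq_fun do rewrite mxE.
  by apply: cvgM; [exact: cb|exact: cvg_cst].
rewrite summxE; under eq_fun do rewrite summxE.
apply: cvgr_sum => k _; rewrite mxE; under eq_fun do rewrite mxE.
by apply: cvgM; [exact: cb|exact: cvg_cst].
Qed.

Lemma cvg_quad_mix_argmin (T : Type) (F : set_system T) {FF : Filter F}
    (b : T -> 'rV[R]_N) (a : 'rV[R]_N) k : simplex a ->
    (forall k, b x 0 k @[x --> F] --> a 0 k) ->
  quad (c k) (g k) (A k) (mix_argmin (b x)) @[x --> F] -->
  quad (c k) (g k) (A k) (mix_argmin a).
Proof.
move=> sa cb; have cs := @cvg_mix_argmin _ F FF _ _ sa cb.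
apply: cvgD; first apply: cvgD; first exact: cvg_cst.
  by apply: (@cvg_dotcv _ _ F _ _ (fun=> g k)) => // i j; exact: cvg_cst.
apply: cvgM; first exact: cvg_cst.
apply: (@cvg_dotcv _ _ F _ _ (fun x => mix_argmin (b x))) => //.
by apply: (@cvg_mulmx_entry _ _ F _ _ _ _ (fun=> A k)) => // i j; exact: cvg_cst.
Qed.

Lemma dual_value_continuous : {within @simplex R N, continuous dual_value}.
Proof.
apply: continuous_in_subspaceT => a /set_mem sa.
(* As a weighted sum of the members' values, the dual involves only products of convergent real
   factors. *)
rewrite /dual_value /continuous_at mix_quadE.
under eq_fun do rewrite mix_quadE.
have ca k : (x : 'rV[R]_N) 0 k @[x --> a] --> a 0 k.
  exact: coord_continuous.
apply: (@cvgr_sum _ _ (nbhs a)) => k _; apply: cvgM; first exact: ca.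
exact: (@cvg_quad_mix_argmin _ (nbhs a)).
Qed.

(* Moving a maximiser [a] of the dual towards the vertex [k] by [e] gives
   [dual a >= dual b >= (1 - e) * dual a + e * q_k (argmin b)], so that
   [q_k (argmin b) <= dual a]; let [e] tend to [0]. *)
Lemma quad_le_dual_max a k : simplex a ->
    (forall b, simplex b -> dual_value b <= dual_value a) ->
  quad (c k) (g k) (A k) (mix_argmin a) <= dual_value a.
Proof.
move=> sa maxa.
pose b (e : R) : 'rV[R]_N := (1 - e) *: a + e *: delta_mx 0 k.
have cb l : b e 0 l @[e --> 0^'+] --> a 0 l by exact: cvg_segment_entry.
apply: (cvgr_to_le (@cvg_quad_mix_argmin _ _ _ b a k sa cb)).
near=> e.
have e0 : 0 < e by near: e; exact: nbhs_right_gt.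
have e1 : e <= 1 by near: e; exact: nbhs_right_le.
have sb : simplex (b e).
  by apply: simplex_convex => //; [rewrite ltW|exact: simplex_delta].
set s := mix_argmin (b e).
have bE : dual_value (b e) =
    (1 - e) * mix_quad a s + e * quad (c k) (g k) (A k) s.
  rewrite /dual_value -/s !mix_quadE mulr_sumr.
  under eq_bigr do rewrite !mxE mulrDl -!mulrA.
  rewrite big_split/=; congr (_ + _).
  rewrite (bigD1 k)//= !eqxx mul1r big1 ?addr0// => l /negPf lk.
  by rewrite lk !mul0r mulr0.
have : (1 - e) * dual_value a <= (1 - e) * mix_quad a s.
  by rewrite ler_wpM2l ?subr_ge0// dual_value_le.
have := maxa _ sb; rewrite bE => *.
by rewrite -(ler_pM2l e0); lra.
Unshelve. all: by end_near. Qed.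

Lemma quad_minimax (k0 : 'I_N) : exists a s, [/\ simplex a,
  mix_hess a *m s = - mix_grad a &
  forall k, quad (c k) (g k) (A k) s <= mix_quad a s].
Proof.
(* The vertex at [k0] makes the simplex nonempty, as the extreme value theorem requires. *)
have [a /set_mem sa maxa] := EVT_max_rV (ex_intro _ _ (@simplex_delta R N k0))
  (@compact_simplex R N) dual_value_continuous.
exists a, (mix_argmin a); split=> //; first exact: mix_argminE.
move=> k; apply: quad_le_dual_max => // b sb; exact/maxa/mem_set.
Qed.

End DualOfQuadraticMinimax.

(** Reindexing along [enum_val] allows the pairs [(j, i)] to index the family; [i0] witnesses that
    it is nonempty. *)
Lemma quad_minimax_finType (R : realType) (n : nat) (I : finType)
    (c : I -> R) (g : I -> 'cV[R]_n) (A : I -> 'M[R]_n) (i0 : I) :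
    (forall i, sym_posdef (A i)) ->
  exists (lam : I -> R) (s : 'cV[R]_n),
    [/\ forall i, 0 <= lam i, \sum_i lam i = 1,
        (\sum_i lam i *: A i) *m s = - \sum_i lam i *: g i &
        forall i, quad (c i) (g i) (A i) s <=
          \sum_l lam l * quad (c l) (g l) (A l) s].
Proof.
move=> pA; have [a [s [[a0 a1] As qs]]] := quad_minimax (c \o enum_val)
  (g \o enum_val) (fun k => pA (enum_val k)) (enum_rank i0).
have sum_enum (V : nmodType) (f : I -> V) :
    \sum_i f i = \sum_(k < #|I|) f (enum_val k).
  by rewrite (reindex _ (onW_bij _ (enum_val_bij I))).
exists (a 0 \o enum_rank), s; split=> [i|||i] /=; first exact: a0.
- by rewrite sum_enum -a1; apply: eq_bigr => k _; rewrite enum_valK.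
- rewrite !sum_enum; under eq_bigr do rewrite enum_valK.
  by rewrite As; congr (- _); apply: eq_bigr => k _; rewrite /= enum_valK.
- rewrite sum_enum; under eq_bigr do rewrite enum_valK.
  by have := qs (enum_rank i); rewrite mix_quadE /= enum_rankK.
Qed.

(** The starting value [f ord0] is itself a member of the family, so a bound on the members also
    bounds it. *)
Lemma maxI_leP (R : realType) (n : nat) (f : 'I_n.+1 -> R) (t : R) :
  maxI f <= t <-> forall i, f i <= t.
Proof.
split=> [ft i|ft]; last exact: bigmax_le.
by apply: le_trans ft; rewrite /maxI; exact: le_bigmax.
Qed.

(** * The subproblem, its epigraph form and its multipliers *)

Section Subproblem.
Variables (R : realType) (n k m p : nat).
Variables (zeta : 'I_m.+1 -> 'cV[R]_n -> 'cV[R]_k -> R).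
Variables (xi : 'I_p.+1 -> 'cV[R]_k).
Variables (H : 'I_m.+1 -> 'cV[R]_n -> 'cV[R]_k -> 'M[R]_n).
Variables (x : 'cV[R]_n).

Local Notation obj := (subproblem_obj zeta xi H x).
Local Notation model := (quad_model zeta xi H x).

Lemma quad_modelE j i s : model j i s =
  quad (zeta j x (xi i) - Fmax zeta xi x j) (grad_zeta zeta xi x j i)
    (H j x (xi i)) s.
Proof. by rewrite /quad_model /quad; ring. Qed.

Lemma subproblem_obj_leP s t : obj s <= t <-> forall i j, model j i s <= t.
Proof.
split=> [/maxI_leP h i j|h]; first by move/maxI_leP: (h j); exact.
by apply/maxI_leP => j; apply/maxI_leP => i; exact: h.
Qed.

Lemma model_le_obj j i s : model j i s <= obj s.
Proof. by move: i j; exact/subproblem_obj_leP. Qed.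

(** The feasible set is the epigraph of [obj], and minimising the height over an epigraph minimises
    the function. *)
Lemma QN_solutionP t s : QN_solution zeta xi H x (t, s) <->
  subproblem_solution zeta xi H x s /\ t = obj s.
Proof.
have feasE u : QN_feasible zeta xi H x u <-> obj u.2 <= u.1.
  exact: iff_sym (subproblem_obj_leP _ _).
split=> [[/feasE/= ts min]|[[_ min] ->]].
  have tE : t = obj s.
    (* The feasible competitor [(obj s, s)] forces [t <= obj s]; feasibility gives the converse. *)
    apply/eqP; rewrite eq_le ts andbT.
    by apply: (min (obj s, s)); apply/feasE.
  split=> //; split=> // s' _; rewrite -tE.
  by apply: (min (obj s', s')); apply/feasE.
split; first exact/feasE.
by move=> [t' s'] /feasE/= ts'; apply: le_trans ts'; exact: min.
Qed.

Hypothesis H_posdef : forall j i, sym_posdef (H j x (xi i)).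

Lemma mix_H_posdef (lam : 'I_p.+1 -> 'I_m.+1 -> R) :
    (forall i j, 0 <= lam i j) -> \sum_j \sum_i lam i j = 1 ->
  sym_posdef (\sum_j \sum_i lam i j *: H j x (xi i)).
Proof.
rewrite !pair_bigA /= => lam0 lam1.
by apply: (posdef_mix (a := fun ji => lam ji.2 ji.1)
  (A := fun ji => H ji.1 x (xi ji.2))).
Qed.

Lemma stationarityE (lam : 'I_p.+1 -> 'I_m.+1 -> R) s :
  \sum_j \sum_i lam i j *: (grad_zeta zeta xi x j i + H j x (xi i) *m s) =
  \sum_j \sum_i lam i j *: grad_zeta zeta xi x j i +
  (\sum_j \sum_i lam i j *: H j x (xi i)) *m s.
Proof.
rewrite !pair_bigA /= mulmx_suml -big_split; apply: eq_bigr => ji _ /=.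
by rewrite scalerDr scalemxAl.
Qed.

(** Stationarity is a linear system in [s] whose matrix, the mixture of the [H], is positive
    definite and hence invertible. *)
Lemma KKT_formula t s lam : KKT_multipliers zeta xi H x (t, s) lam ->
  (\sum_j \sum_i lam i j *: H j x (xi i)) \in unitmx /\
  s = - (invmx (\sum_j \sum_i lam i j *: H j x (xi i)) *m
         \sum_j \sum_i lam i j *: grad_zeta zeta xi x j i).
Proof.
move=> [lam0 lam1 + _]; rewrite stationarityE /= => /eqP.
have uH := posdef_unitmx (mix_H_posdef lam0 lam1).
by rewrite addr_eq0 => /eqP ->; rewrite mulmxN opprK mulKmx.
Qed.

(** The optimal dual weights over the pairs [(j, i)] serve as multipliers. *)
Lemma KKT_exists : exists s lam,
  KKT_multipliers zeta xi H x (obj s, s) lam.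
Proof.
pose I := ('I_m.+1 * 'I_p.+1)%type.
pose c (ji : I) := zeta ji.1 x (xi ji.2) - Fmax zeta xi x ji.1.
pose g (ji : I) := grad_zeta zeta xi x ji.1 ji.2.
pose A (ji : I) := H ji.1 x (xi ji.2).
have [lam [s [lam0 lam1 st le_mix]]] := quad_minimax_finType c g
  (ord0, ord0) (fun ji => H_posdef ji.1 ji.2 : sym_posdef (A ji)).
set v := \sum_l _ in le_mix.
have mE ji : quad (c ji) (g ji) (A ji) s = model ji.1 ji.2 s.
  by rewrite quad_modelE.
(* Every model is at most the weighted mean [v], and a weighted mean is at most the maximum, so the
   two agree. *)
have objE : obj s = v.
  apply/eqP; rewrite eq_le; apply/andP; split.
    by apply/subproblem_obj_leP => i j; rewrite (quad_modelE j i) (le_mix (j, i)).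
  rewrite -[leRHS]mul1r -lam1 mulr_suml; apply: ler_sum => ji _.
  by rewrite ler_wpM2l// mE model_le_obj.
exists s, (fun i j => lam (j, i)); split=> //= [||i j].
- by rewrite pair_bigA -lam1; apply: eq_bigr => -[].
- rewrite stationarityE !pair_bigA; apply/eqP; rewrite addrC addr_eq0; apply/eqP.
  by under eq_bigr do rewrite -surjective_pairing; rewrite st; congr (- _);
    apply: eq_bigr => -[].
(* Complementary slackness: the weighted slacks are nonnegative and sum to zero, so each is zero. *)
- have : \sum_l lam l * (obj s - model l.1 l.2 s) = 0.
    under eq_bigr do rewrite mulrBr -mE.
    by rewrite sumrB -mulr_suml lam1 mul1r objE subrr.
  move/psumr_eq0P => zero; rewrite -opprB mulrN.
  rewrite (zero _ (j, i)) ?oppr0// => l _.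
  by rewrite mulr_ge0// subr_ge0 model_le_obj.
Qed.

(** The Lagrangian [L] meets [obj] at [s] by complementary slackness, is an average of models and so
    never exceeds [obj], and is strictly minimised at [s]: [obj s = L s < L s' <= obj s']. *)
Lemma KKT_strict_min s lam : KKT_multipliers zeta xi H x (obj s, s) lam ->
  forall s', s' != s -> obj s < obj s'.
Proof.
move=> [lam0 lam1 st cs] s' s's; rewrite stationarityE /= in st.
pose L u := \sum_j \sum_i lam i j * model j i u.
have LE u : L u = quad
    (\sum_j \sum_i lam i j * (zeta j x (xi i) - Fmax zeta xi x j))
    (\sum_j \sum_i lam i j *: grad_zeta zeta xi x j i)
    (\sum_j \sum_i lam i j *: H j x (xi i)) u.
  rewrite /L !pair_bigA quad_mix.
  by apply: eq_bigr => ji _; rewrite quad_modelE.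
have Ls : L s = obj s.
  rewrite -[RHS]mul1r -lam1 mulr_suml; apply: eq_bigr => j _.
  rewrite mulr_suml; apply: eq_bigr => i _.
  by apply/eqP; rewrite -subr_eq0 -mulrBr cs.
rewrite -Ls; apply: (@lt_le_trans _ _ (L s')).
  rewrite !LE; apply: quad_min_strict s's; first exact: mix_H_posdef.
  by apply/eqP; rewrite -addr_eq0 addrC st.
rewrite -[leRHS]mul1r -lam1 mulr_suml; apply: ler_sum => j _.
rewrite mulr_suml; apply: ler_sum => i _.
by rewrite ler_wpM2l// model_le_obj.
Qed.

End Subproblem.

Theorem theorem3p1 (R : realType) (n k m p : nat)
    (zeta : 'I_m.+1 -> 'cV[R]_n -> 'cV[R]_k -> R)
    (xi : 'I_p.+1 -> 'cV[R]_k)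
    (H : 'I_m.+1 -> 'cV[R]_n -> 'cV[R]_k -> 'M[R]_n)
    (x : 'cV[R]_n)
    (zeta_C2 : forall j i, C2 (fun y => zeta j y (xi i)))
    (zeta_convex : forall j i, strictly_convex (fun y => zeta j y (xi i)))
    (H_posdef : forall j i, sym_posdef (H j x (xi i))) :
  exists s : 'cV[R]_n,
    [/\ unique (subproblem_solution zeta xi H x) s,
        forall (t' : R) (s' : 'cV[R]_n),
          QN_solution zeta xi H x (t', s') <->
          subproblem_solution zeta xi H x s' /\
          t' = subproblem_obj zeta xi H x s',
        exists lam : 'I_p.+1 -> 'I_m.+1 -> R,
          KKT_multipliers zeta xi H x (subproblem_obj zeta xi H x s, s) lam &
        forall lam : 'I_p.+1 -> 'I_m.+1 -> R,
          KKT_multipliers zeta xi H x (subproblem_obj zeta xi H x s, s) lam ->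
          (\sum_j \sum_i lam i j *: H j x (xi i)) \in unitmx /\
          s = - (invmx (\sum_j \sum_i lam i j *: H j x (xi i)) *m
                 \sum_j \sum_i lam i j *: grad_zeta zeta xi x j i)].
Proof.
have [s [lam kkt]] := KKT_exists zeta H_posdef.
(* One multiplier vector at [s] makes [s] a strict global minimiser, which settles existence and
   uniqueness together. *)
have lt_obj := KKT_strict_min H_posdef kkt.
exists s; split; [split|exact: QN_solutionP|by exists lam|].
- by split=> // s' _; have [->//|/lt_obj/ltW] := eqVneq s' s.
- move=> s' [_ min]; apply/eqP; rewrite eq_sym.
  by apply: contraT => /lt_obj; rewrite ltNge min.
- by move=> lam' /(KKT_formula H_posdef).
Qed.
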